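(* Let $k$ be an algebraically closed field and let $X=\operatorname{Spec} R$ be the scheme associated to an irreducible affine variety over $k$ (so $R$ is an integral domain finitely generated as a $k$-algebra). Let $C=\mathbb{A}^1_k\setminus\{0\}$. Then exactly one of the following is true: (1) $R$ is unit-additive, and all $k$-scheme morphisms $X\to C$ are constant. (2) $R$ is not unit-additive, and there is a dominant $k$-scheme morphism $X\to C$. Moreover, any such (dominant) morphism has cofinite image, i.e. the complement of its image in $C$ is finite.
   Context: All rings are commutative and unital. A ring $R$ is unit-additive if whenever $u,v$ are units of $R$, $u+v$ is either a unit of $R$ or a nilpotent element. *)

(* Defs.v *)
From HB Require Import structures.
From mathcomp Require Import all_boot all_order all_algebra.
From mathcomp Require Import ring_quotient.
From mathcomp Require Import all_classical topology.

Set Implicit Arguments.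
Unset Strict Implicit.
Unset Printing Implicit Defensive.

Import GRing.Theory.
Local Open Scope classical_set_scope.
Local Open Scope ring_scope.

Definition unit_additive (R : comUnitRingType) : Prop :=
  forall u v : R, u \is a GRing.unit -> v \is a GRing.unit ->
    u + v \is a GRing.unit \/ exists n : nat, (u + v) ^+ n = 0.

(* The k-algebra structure on R is the ring morphism i : k -> R. *)
Definition finitely_generated (k R : comNzRingType) (i : {rmorphism k -> R}) :
    Prop :=
  exists gens : seq R, forall S : {pred R}, subring_closed S ->
    (forall a, i a \in S) -> {subset gens <= S} -> forall x, x \in S.

Record opens (X : topologicalType) :=
  Opens { oset :> set X; oset_open : open oset }.

(* Locally ringed spaces over k. Stalks are not formed: a germ s_x is a unit
   of the local ring O_x iff s is invertible on a neighbourhood of x, and this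
   is all that locality needs. The zero ring must be allowed as the ring of
   sections over the empty set, whence comPzRingType. *)
Definition germ_unit (X : topologicalType) (O : opens X -> comPzRingType)
    (res : forall U V : opens X, V `<=` U -> {rmorphism O U -> O V})
    (U : opens X) (s : O U) (x : X) : Prop :=
  exists (V : opens X) (VU : V `<=` U),
    oset V x /\ exists t : O V, res U V VU s * t = 1.

Record lrspace (k : comNzRingType) := LRSpace {
  space :> topologicalType;
  sec : opens space -> comPzRingType;
  res : forall U V : opens space, V `<=` U -> {rmorphism sec U -> sec V};
  scal : forall U : opens space, {rmorphism k -> sec U};
  res_id : forall (U : opens space) (UU : U `<=` U) s, res UU s = s;
  res_comp : forall (U V W : opens space) (VU : V `<=` U) (WV : W `<=` V)
    (WU : W `<=` U) s, res WV (res VU s) = res WU s;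
  res_scal : forall (U V : opens space) (VU : V `<=` U) a,
    res VU (scal U a) = scal V a;
  sec_separated : forall (U : opens space) (I : Type) (V : I -> opens space)
    (VU : forall i, V i `<=` U), U `<=` \bigcup_i V i ->
    forall s t : sec U, (forall i, res (VU i) s = res (VU i) t) -> s = t;
  sec_glue : forall (U : opens space) (I : Type) (V : I -> opens space)
    (VU : forall i, V i `<=` U), U `<=` \bigcup_i V i ->
    forall s : forall i, sec (V i),
    (forall i j (W : opens space) (Wi : W `<=` V i) (Wj : W `<=` V j),
      res Wi (s i) = res Wj (s j)) ->
    exists t : sec U, forall i, res (VU i) t = s i;
  stalk_neq0 : forall (U : opens space) x, ~ germ_unit res (0 : sec U) x;
  stalk_local : forall (U : opens space) (s t : sec U) x, oset U x ->
    germ_unit res (s + t) x -> germ_unit res s x \/ germ_unit res t x }.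

Definition preim_opens (X Y : topologicalType) (f : X -> Y)
    (cf : continuous f) (V : opens Y) : opens X :=
  Opens ((continuousP f).1 cf _ (oset_open V)).

(* Morphisms of locally ringed spaces over k; between k-schemes these are the
   morphisms of k-schemes. *)
Record lrspace_mor (k : comNzRingType) (X Y : lrspace k) := LRSpaceMor {
  mor :> X -> Y;
  mor_continuous : continuous mor;
  comor : forall V : opens Y,
    {rmorphism sec V -> sec (preim_opens mor_continuous V)};
  comor_res : forall (V W : opens Y) (WV : W `<=` V)
    (fWV : preim_opens mor_continuous W `<=` preim_opens mor_continuous V) s,
    comor W (res WV s) = res fWV (comor V s);
  comor_scal : forall (V : opens Y) a, comor V (scal V a) = scal _ a;
  comor_local : forall (V : opens Y) (s : sec V) x, oset V (mor x) ->
    germ_unit (@res k X) (comor V s) x -> germ_unit (@res k Y) s (mor x) }.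

(* f factors through Spec k: it has a single image point, and it pulls every
   function back to a scalar. *)
Definition constant_mor (k : comNzRingType) (X Y : lrspace k)
    (f : lrspace_mor X Y) : Prop :=
  (exists y, forall x, f x = y) /\
  (forall (V : opens Y) (s : sec V), exists a, comor f V s = scal _ a).

Definition dominant_mor (k : comNzRingType) (X Y : lrspace k)
    (f : lrspace_mor X Y) : Prop :=
  dense (range f).

Section OpenSubspace.
Variables (k : comNzRingType) (X : lrspace k) (U : opens X).

Let T : topologicalType := U : Type.

Lemma image_open (V : opens T) : open (set_val @` V).
Proof.
case: V => V [W oW /= <-].
have -> : set_val @` (set_val @^-1` W : set T) = W `&` U.
  apply/seteqP; split=> [_ [[x Ux] /= Wx <-]|x [Wx Ux]].
    by split=> //; exact: set_mem.
  by exists (exist _ x (mem_set Ux)).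
exact: openI oW (oset_open U).
Qed.

Definition image_opens (V : opens T) : opens X := Opens (image_open V).

Definition open_sec (V : opens T) : comPzRingType := sec (image_opens V).

Definition open_res (V W : opens T) (WV : W `<=` V) :
    {rmorphism open_sec V -> open_sec W} :=
  @res k X (image_opens V) (image_opens W) (image_subset _ WV).

Definition open_scal (V : opens T) : {rmorphism k -> open_sec V} :=
  @scal k X (image_opens V).

Lemma preim_open (W : opens X) : open (set_val @^-1` W : set T).
Proof. by exists W => //; exact: oset_open. Qed.

Definition trace_opens (W : opens X) : opens T := Opens (preim_open W).

Lemma image_trace (W : opens X) :
  W `<=` U -> image_opens (trace_opens W) `<=>` W.
Proof.
move=> WU; split=> [_ [x Wx <-] //|x Wx].
by exists (exist _ x (mem_set (WU _ Wx))).
Qed.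

Lemma image_sub (V : opens T) : image_opens V `<=` U.
Proof. by move=> _ [[x Ux] _ <-]; exact: set_mem. Qed.

Lemma trace_sub (W : opens X) (V : opens T) :
  W `<=` image_opens V -> trace_opens W `<=` V.
Proof. by move=> WV x /= /WV [y Vy /val_inj <-]. Qed.

Lemma open_germ_unit (V : opens T) (s : open_sec V) (x : T) :
  germ_unit open_res s x <->
  germ_unit (@res k X) (s : sec (image_opens V)) (set_val x).
Proof.
split=> [[W [WV [Wx [t st]]]]|[W [WV [Wx [t st]]]]].
  by exists (image_opens W), (image_subset _ WV); split; [exists x|exists t].
exists (trace_opens W), (trace_sub WV); split=> //.
have [WW _] := image_trace (subset_trans WV (@image_sub V)).
exists (res WW t); move/(congr1 (res WW)): st.
rewrite rmorphM rmorph1 => <-; congr (_ * _).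
by rewrite (res_comp WV WW (image_subset _ (trace_sub WV))).
Qed.

Lemma image_cover (V : opens T) I (W : I -> opens T) :
  V `<=` \bigcup_i W i -> image_opens V `<=` \bigcup_i image_opens (W i).
Proof. by move=> VW _ [x /VW [i _ Wx] <-]; exists i => //; exists x. Qed.

Definition open_subspace : lrspace k.
Proof.
apply: (@LRSpace k T open_sec open_res open_scal).
- by move=> *; exact: res_id.
- by move=> *; exact: res_comp.
- by move=> *; exact: res_scal.
- move=> V I W WV /image_cover cV s t st.
  exact: (@sec_separated k X (image_opens V) I (image_opens \o W)
    (fun i => image_subset _ (WV i)) cV s t st).
- move=> V I W WV /image_cover cV s ss.
  apply: (@sec_glue k X (image_opens V) I (image_opens \o W)
    (fun i => image_subset _ (WV i)) cV) => i j Z Zi Zj.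
  have [_ ZZ] := image_trace (subset_trans Zi (@image_sub _)).
  have := ss i j (trace_opens Z) (trace_sub Zi) (trace_sub Zj).
  by move=> /(congr1 (res ZZ)); rewrite !(res_comp _ _ Zi) (res_comp _ _ Zj).
- by move=> V x /open_germ_unit; exact: stalk_neq0.
- move=> V s t x Vx /open_germ_unit stx; rewrite !open_germ_unit.
  by apply: stalk_local stx; exists x.
Defined.

End OpenSubspace.

Definition spec (A : nzRingType) : Type := prime_idealr A.

HB.instance Definition _ (A : nzRingType) := gen_eqMixin (spec A).
HB.instance Definition _ (A : nzRingType) := gen_choiceMixin (spec A).

Section Zariski.
Variable A : comNzRingType.

Definition zero_locus (E : set A) : set (spec A) :=
  [set p : spec A | forall a, E a -> a \in (p : prime_idealr A)].

Definition zariski_open (U : set (spec A)) : Prop :=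
  exists E : set A, U = ~` zero_locus E.

Lemma zariski_openT : zariski_open setT.
Proof.
exists [set 1]; apply/esym/seteqP; split=> // p _ /(_ 1 erefl).
by rewrite idealr1.
Qed.

Lemma zariski_openI : setI_closed zariski_open.
Proof.
move=> _ _ [E ->] [F ->]; exists [set a * b | a in E & b in F].
rewrite -setCU; congr (~` _); apply/seteqP; split=> [p|p pEF].
  case=> pE _ [a Ea [b Fb <-]]; rewrite prime_idealrM.
    by rewrite (pE a Ea).
  by rewrite (pE b Fb) orbT.
apply: contrapT => /not_orP[/existsNP[a /not_implyP[Ea pa]]].
move=> /existsNP[b /not_implyP[Fb pb]].
have /pEF : [set a * b | a in E & b in F] (a * b) by exists a => //; exists b.
by rewrite prime_idealrM => /orP[].
Qed.

Lemma zariski_open_bigU I (U : I -> set (spec A)) :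
  (forall i, zariski_open (U i)) -> zariski_open (\bigcup_i U i).
Proof.
move=> /choice[E UE]; exists (\bigcup_i E i); apply/seteqP; split=> p.
  by move=> [i _]; rewrite UE => + pE; apply=> a Ea; apply: pE; exists i.
move=> /existsNP[a /not_implyP[[i _ Ea] pa]].
by exists i => //; rewrite UE => /(_ a Ea).
Qed.

End Zariski.

HB.instance Definition _ (A : comNzRingType) :=
  isOpenTopological.Build (spec A) (@zariski_openT A) (@zariski_openI A)
    (@zariski_open_bigU A).

Lemma basic_open_open (A : comNzRingType) (f : A) :
  open [set p : spec A | f \notin (p : prime_idealr A)].
Proof.
exists [set f]; apply/seteqP; split=> p /=.
  by move=> /negP fp /(_ f erefl).
by move=> fp; apply/negP => pf; apply: fp => _ ->.
Qed.

Definition basic_open (A : comNzRingType) (f : A) : opens (spec A) :=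
  Opens (basic_open_open f).

(* A section over U is a function on U with values in the localizations, which
   is locally a fraction a / b; as A is a domain, the localization at a prime p
   is viewed inside the fraction field, as the set of a / b with b \notin p. *)
Section StructureSheaf.
Variables (k : comNzRingType) (A : idomainType) (i : {rmorphism k -> A}).
Implicit Types U V W : opens (spec A).

Local Notation "x %:F" := (@tofrac A x).

Definition locally_fraction U (s : oset U -> {fraction A}) : Prop :=
  forall p : oset U, exists (V : opens (spec A)) (a b : A),
    oset V (val p) /\
    forall q : oset U, oset V (val q) ->
      b \notin (val q : prime_idealr A) /\ s q = a%:F / b%:F.

Record spec_sec U := SpecSec {
  spec_fun :> oset U -> {fraction A};
  _ : `[< locally_fraction spec_fun >] }.

Lemma locally_fraction_cst U (a : A) :
  locally_fraction (fun _ : oset U => a%:F).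
Proof.
move=> p; exists U, a, 1; split; first exact: set_valP.
by move=> q _; rewrite idealr1 tofrac1 divr1.
Qed.

Lemma nonideal_neq0 (p : spec A) (b : A) :
  b \notin (p : prime_idealr A) -> b%:F != 0.
Proof.
by move=> bp; rewrite tofrac_eq0; apply: contraNneq bp => ->; exact: idealr0.
Qed.

Definition opensI U V : opens (spec A) :=
  Opens (openI (oset_open U) (oset_open V)).

Lemma locally_fraction_subring U :
  subring_closed [pred s : oset U -> {fraction A} | `[< locally_fraction s >]].
Proof.
split=> [|s t /asboolP ls /asboolP lt|s t /asboolP ls /asboolP lt].
- by apply/asboolP => p; have := locally_fraction_cst 1 p; rewrite tofrac1.
- apply/asboolP => p.
  have [V [a [b [Vp sV]]]] := ls p; have [W [c [d [Wp tW]]]] := lt p.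
  exists (opensI V W), (a * d - c * b), (b * d); split=> // q.
  move=> [/sV[bq sq] /tW[dq tq]].
  rewrite prime_idealrM negb_or bq dq; split=> //.
  have -> : (s - t) q = s q - t q by [].
  rewrite sq tq -mulNr addf_div ?(nonideal_neq0 bq) ?(nonideal_neq0 dq)//.
  by rewrite mulNr tofracB !tofracM.
- apply/asboolP => p.
  have [V [a [b [Vp sV]]]] := ls p; have [W [c [d [Wp tW]]]] := lt p.
  exists (opensI V W), (a * c), (b * d); split=> // q.
  move=> [/sV[bq sq] /tW[dq tq]].
  rewrite prime_idealrM negb_or bq dq; split=> //.
  have -> : (s * t) q = s q * t q by [].
  by rewrite sq tq mulf_div !tofracM.
Qed.

HB.instance Definition _ U := [isSub for @spec_fun U].
HB.instance Definition _ U := [Choice of spec_sec U by <:].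
HB.instance Definition _ U :=
  GRing.SubChoice_isSubComPzRing.Build _ _ (spec_sec U)
    (@locally_fraction_subring U).

Lemma spec_secP U (s t : spec_sec U) : (forall p, s p = t p) -> s = t.
Proof. by move=> st; apply/val_inj/funext. Qed.

Lemma spec_sec_frac U (s : spec_sec U) : locally_fraction s.
Proof. by case: s => s /= /asboolP. Qed.

Definition sub_point U V (VU : V `<=` U) (p : oset V) : oset U :=
  exist _ (val p) (mem_set (VU _ (set_valP p))).

Lemma spec_res_subproof U V (VU : V `<=` U) (s : spec_sec U) :
  `[< locally_fraction (s \o sub_point VU) >].
Proof.
apply/asboolP => p.
have [W [a [b [Wp sW]]]] := spec_sec_frac s (sub_point VU p).
by exists W, a, b; split=> // q Wq; exact: (sW (sub_point VU q)).
Qed.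

Definition spec_res U V (VU : V `<=` U) (s : spec_sec U) : spec_sec V :=
  SpecSec (spec_res_subproof VU s).

Lemma spec_res_zmod U V (VU : V `<=` U) : zmod_morphism (spec_res VU).
Proof. by move=> s t; exact: spec_secP. Qed.

Lemma spec_res_monoid U V (VU : V `<=` U) : monoid_morphism (spec_res VU).
Proof. by split=> [|s t]; exact: spec_secP. Qed.

HB.instance Definition _ U V (VU : V `<=` U) :=
  GRing.isZmodMorphism.Build _ _ (spec_res VU) (spec_res_zmod VU).
HB.instance Definition _ U V (VU : V `<=` U) :=
  GRing.isMonoidMorphism.Build _ _ (spec_res VU) (spec_res_monoid VU).

Definition spec_scal U (c : k) : spec_sec U :=
  SpecSec (asboolT (@locally_fraction_cst U (i c))).

Lemma spec_scal_zmod U : zmod_morphism (spec_scal U).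
Proof.
move=> c d; apply: spec_secP => p.
by transitivity ((i c)%:F - (i d)%:F); rewrite //= !rmorphB.
Qed.

Lemma spec_scal_monoid U : monoid_morphism (spec_scal U).
Proof.
split=> [|c d]; apply: spec_secP => p /=; first by rewrite !rmorph1.
by rewrite !rmorphM.
Qed.

HB.instance Definition _ U :=
  GRing.isZmodMorphism.Build _ _ (spec_scal U) (spec_scal_zmod U).
HB.instance Definition _ U :=
  GRing.isMonoidMorphism.Build _ _ (spec_scal U) (spec_scal_monoid U).

Local Notation res := (fun (U V : opens (spec A)) (VU : V `<=` U) =>
  spec_res VU : {rmorphism spec_sec U -> spec_sec V}).

Lemma spec_glue U (I : Type) (V : I -> opens (spec A))
    (VU : forall j, V j `<=` U) : U `<=` \bigcup_j V j ->
  forall s : forall j, spec_sec (V j),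
  (forall j l (W : opens (spec A)) (Wj : W `<=` V j) (Wl : W `<=` V l),
    spec_res Wj (s j) = spec_res Wl (s l)) ->
  exists t : spec_sec U, forall j, spec_res (VU j) t = s j.
Proof.
move=> UV s ss.
have ssE j l (x : spec A) (xj : x \in oset (V j)) (xl : x \in oset (V l)) :
    s j (exist _ x xj) = s l (exist _ x xl).
  have Wj : opensI (V j) (V l) `<=` V j by move=> ? [].
  have Wl : opensI (V j) (V l) `<=` V l by move=> ? [].
  have xW : x \in oset (opensI (V j) (V l)).
    by apply/mem_set; split; exact: set_mem.
  have /(congr1 (fun u : spec_sec _ => u (exist _ x xW))) := ss j l _ Wj Wl.
  rewrite /= /sub_point /=; congr (s j _ = s l _); exact: val_inj.
have /choice[g gV] (p : oset U) : exists j, oset (V j) (val p).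
  by have [j _ Vp] := UV _ (set_valP p); exists j.
pose t (p : oset U) := s (g p) (exist _ (val p) (mem_set (gV p))).
have tE j (p : oset (V j)) : t (sub_point (VU j) p) = s j p.
  by case: p => x xj; exact: ssE.
have lt : locally_fraction t.
  move=> p; have pj := mem_set (gV p).
  have [W [a [b [Wp sW]]]] := spec_sec_frac (s (g p)) (exist _ (val p) pj).
  exists (opensI W (V (g p))), a, b; split; first by split=> //; exact: gV.
  move=> q [Wq Vq]; have [bq <-] := sW (exist _ (val q) (mem_set Vq)) Wq.
  by split=> //; exact: ssE.
by exists (SpecSec (asboolT lt)) => j; apply: spec_secP => p; exact: tE.
Qed.

Lemma frac_eq (a b c d : A) :
  b != 0 -> d != 0 -> a%:F / b%:F = c%:F / d%:F -> a * d = c * b.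
Proof.
move=> b0 d0 /eqP; rewrite eqr_div ?tofrac_eq0// -!tofracM tofrac_eq.
by move/eqP.
Qed.

Lemma notin_neq0 (p : spec A) (b : A) : b \notin (p : prime_idealr A) -> b != 0.
Proof. by apply: contraNneq => ->; exact: idealr0. Qed.

Lemma spec_germ_unit U (s : spec_sec U) (p : oset U) :
  germ_unit res s (val p) <-> exists a b : A,
    [/\ a \notin (val p : prime_idealr A), b \notin (val p : prime_idealr A) &
        s p = a%:F / b%:F].
Proof.
split=> [[V [VU [Vp [t st]]]]|[a [b [ap bp sp]]]].
  have [W [a [b [Wp /(_ p Wp)[bp sp]]]]] := spec_sec_frac s p.
  pose q : oset V := exist _ (val p) (mem_set Vp).
  have [W' [c [d [W'p /(_ q W'p)[/= dp tq]]]]] := spec_sec_frac t q.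
  exists a, b; split=> //.
  have /(congr1 (fun u : spec_sec _ => u q)) := st.
  have -> : (spec_res VU s * t : spec_sec V) q = s (sub_point VU q) * t q by [].
  have -> : sub_point VU q = p by exact: val_inj.
  have -> : (1 : spec_sec V) q = 1%:F / 1%:F by rewrite tofrac1 divr1.
  rewrite sp tq mulf_div -!tofracM.
  have bd : b * d \notin (val p : prime_idealr A).
    by rewrite prime_idealrM negb_or bp.
  move/frac_eq => /(_ (notin_neq0 bd) (oner_neq0 _)); rewrite mulr1 mul1r => ac.
  by move: bd; rewrite -ac prime_idealrM negb_or => /andP[].
have [W [c [d [Wp sW]]]] := spec_sec_frac s p.
have [dp sp'] := sW p Wp.
have cp : c \notin (val p : prime_idealr A).
  have : c * b \notin (val p : prime_idealr A).
    rewrite (frac_eq (notin_neq0 dp) (notin_neq0 bp) (etrans (esym sp') sp)).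
    by rewrite prime_idealrM negb_or ap.
  by rewrite prime_idealrM negb_or => /andP[].
pose V := opensI (opensI W U) (basic_open c).
have VU : V `<=` U by move=> ? [[]].
have lt : locally_fraction (fun _ : oset V => d%:F / c%:F).
  move=> q; exists V, d, c; split; first exact: set_valP.
  by move=> r [_ cr].
exists V, VU; split; first by split=> //; split=> //; exact: set_valP.
exists (SpecSec (asboolT lt)); apply: spec_secP => q.
have [[Wq _] cq] := set_valP q.
have [dq sq] := sW (sub_point VU q) Wq.
transitivity (s (sub_point VU q) * (d%:F / c%:F)) => //.
by rewrite sq mulrA divfK ?(nonideal_neq0 dq)// divff ?(nonideal_neq0 cq).
Qed.

Definition affine_scheme : lrspace k.
Proof.
apply: (@LRSpace k (spec A) spec_sec res (fun U => spec_scal U)).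
- by move=> U UU s; apply: spec_secP => p /=; congr (s _); exact: val_inj.
- by move=> *; apply: spec_secP => p /=; congr (_ _); exact: val_inj.
- by move=> *; exact: spec_secP.
- move=> U I V VU UV s t st; apply: spec_secP => p.
  have [j _ Vp] := UV _ (set_valP p).
  pose q : oset (V j) := exist _ (val p) (mem_set Vp).
  have := congr1 (fun u : spec_sec _ => u q) (st j).
  by rewrite /=; congr (s _ = t _); exact: val_inj.
- exact: spec_glue.
- move=> U p [V [VU [Vp [t]]]]; rewrite rmorph0 mul0r.
  move/(congr1 (fun u : spec_sec _ => u (exist _ p (mem_set Vp)))).
  by move/eqP; rewrite eq_sym oner_eq0.
- move=> U s t p Up; pose q : oset U := exist _ p (mem_set Up).
  rewrite -[p]/(val q) !spec_germ_unit => -[a [b [ap bp]]].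
  have [V [c [d [Vp /(_ q Vp)[dp sq]]]]] := spec_sec_frac s q.
  have [W [e [f [Wp /(_ q Wp)[fp tq]]]]] := spec_sec_frac t q.
  have -> : (s + t : spec_sec U) q = s q + t q by [].
  rewrite sq tq addf_div ?(nonideal_neq0 dp) ?(nonideal_neq0 fp)//.
  rewrite -!tofracM -tofracD.
  have df : d * f \notin (val q : prime_idealr A).
    by rewrite prime_idealrM negb_or dp.
  move/frac_eq => /(_ (notin_neq0 df) (notin_neq0 bp)) E.
  have [cp|cp] := boolP (c \in (p : prime_idealr A)); last first.
    by left; exists c, d.
  right; exists e, f; split=> //; apply/negP => ep.
  have : (c * f + e * d) * b \notin (p : prime_idealr A).
    by rewrite E prime_idealrM negb_or ap.
  by rewrite prime_idealrM rpredD ?prime_idealrM ?cp ?ep.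
Defined.

End StructureSheaf.

(* The affine line without its origin, as an open subscheme of Spec k[X]. *)
Definition punctured_line (k : fieldType) : lrspace k :=
  @open_subspace k (affine_scheme (polyC : {rmorphism k -> {poly k}}))
    (basic_open 'X).

(* Main.v *)
(* A morphism f from Spec R to the punctured line is determined by the unit
   u of R that is the pullback of the coordinate: f p = {h | h(u) \in p}.
   If u = i c with c in k, then f is constant. Otherwise u is transcendental
   over k, and the classical extension of homomorphisms k[u] -> k along the
   finitely generated extension k[u] <= R yields a nonzero polynomial a such
   that u - i c is not a unit whenever a(c) <> 0. This single fact does two
   jobs. If R is unit-additive, it forces every unit u into k, since
   u + i (-c) would be a unit for all c <> 0. And it shows that f misses at
   most the generic point and the points c with a(c) = 0. Conversely, units
   v, w with v + w neither a unit nor 0 give the unit v / w outside k, and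
   any such unit u defines a dominant morphism by contraction of primes along
   the injection k[T] -> R, T |-> u. *)

Require Import Defs.
From HB Require Import structures.
From mathcomp Require Import all_boot all_order all_algebra.
From mathcomp Require Import ring_quotient fraction.
From mathcomp Require Import all_classical topology.

Set Implicit Arguments.
Unset Strict Implicit.
Unset Printing Implicit Defensive.

Import GRing.Theory.
Local Open Scope classical_set_scope.
Local Open Scope ring_scope.

(** * Evaluation of polynomials along a ring morphism *)

Section Adjoin.
Variables (A B : comNzRingType) (j : {rmorphism A -> B}) (x : B).

Definition adjoin (h : {poly A}) : B := (map_poly j h).[x].

Let comm_x : commr_rmorph j x := fun a => mulrC x (j a).

Lemma adjoin_zmod : zmod_morphism adjoin.
Proof. exact: (rmorphB (horner_morph comm_x)). Qed.

Lemma adjoin_monoid : monoid_morphism adjoin.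
Proof.
split; first exact: (rmorph1 (horner_morph comm_x)).
exact: (rmorphM (horner_morph comm_x)).
Qed.

HB.instance Definition _ :=
  GRing.isZmodMorphism.Build _ _ adjoin adjoin_zmod.
HB.instance Definition _ :=
  GRing.isMonoidMorphism.Build _ _ adjoin adjoin_monoid.

Lemma adjoinE h : adjoin h = (map_poly j h).[x].
Proof. by []. Qed.

Lemma adjoinC a : adjoin a%:P = j a.
Proof. exact: (horner_morphC comm_x). Qed.

Lemma adjoinX : adjoin 'X = x.
Proof. exact: (horner_morphX comm_x). Qed.

Lemma adjoinZ a h : adjoin (a *: h) = j a * adjoin h.
Proof. by rewrite -mul_polyC rmorphM /= adjoinC. Qed.

Lemma adjoin_uniq (g : {rmorphism {poly A} -> B}) :
  (forall a, g a%:P = j a) -> g 'X = x -> g =1 adjoin.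
Proof.
move=> gC gX; elim/poly_ind => [|p c IH]; first by rewrite !rmorph0.
by rewrite !rmorphD !rmorphM /= IH gC gX adjoinC adjoinX.
Qed.

End Adjoin.

Lemma ex_min_size (A : nzRingType) (P : {poly A} -> Prop) :
  (exists p, P p) ->
  exists2 p, P p & forall q, P q -> (size p <= size q)%N.
Proof.
move=> [p Pp].
have ex : exists n, (fun n => `[< exists2 q, P q & size q = n >]) n.
  by exists (size p); apply/asboolP; exists p.
have [n /asboolP[q Pq <-] minq] := find_ex_minn ex.
by exists q => // r Pr; apply: minq; apply/asboolP; exists r.
Qed.

(* The subrings of [R] in the specialization argument are images of maps
   [j : A -> R], with [A] growing by one polynomial variable at each step; a
   morphism on the subring is a morphism on [A] that kills the kernel of [j]. *)
Definition factors_through (A B C : comNzRingType) (j : {rmorphism A -> B})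
    (phi : {rmorphism A -> C}) : Prop :=
  forall a, j a = 0 -> phi a = 0.

(** * Specialization of finitely generated extensions *)

Section Specialization.
Variables (k : closedFieldType) (R : idomainType).

Section Step.
Variables (A : comNzRingType) (j : {rmorphism A -> R}) (x : R).

Local Notation jx := (adjoin j x).

(** As [j] may have a kernel, the top coefficients of [h] can die in [R]. Truncation removes exactly
    these, so that degrees may be compared over [A]. *)
Lemma map_poly_take (h : {poly A}) :
  map_poly j (take_poly (size (map_poly j h)) h) = map_poly j h.
Proof.
apply/polyP => n; rewrite !coef_map coef_take_poly.
case: ltnP => // le_n; rewrite raddf0.
by have := nth_default 0 le_n; rewrite coef_map.
Qed.

Lemma adjoin_take (h : {poly A}) :
  jx (take_poly (size (map_poly j h)) h) = jx h.
Proof. by rewrite !adjoinE map_poly_take. Qed.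

(** Truncation does not change the image under [j], hence preserves [P]; a shortest [p] therefore
    cannot be shortened, and its leading coefficient survives in [R]. *)
Lemma size_map_min (P : {poly A} -> Prop) (p : {poly A}) :
  (forall q r, map_poly j q = map_poly j r -> P q -> P r) ->
  P p -> (forall q, P q -> (size p <= size q)%N) ->
  size (map_poly j p) = size p.
Proof.
move=> Pmap Pp minp; apply/eqP; rewrite eqn_leq size_poly /=.
apply: leq_trans (size_take_poly (size (map_poly j p)) p).
by apply/minp/(Pmap p) => //; rewrite map_poly_take.
Qed.

Lemma size_map_lead (p : {poly A}) :
  p != 0 -> size (map_poly j p) = size p -> j (lead_coef p) != 0.
Proof.
move=> p0 sp; have: lead_coef (map_poly j p) != 0.
  by rewrite lead_coef_eq0 -size_poly_eq0 sp size_poly_eq0.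
by rewrite {1}lead_coefE sp coef_map.
Qed.

(** The witness is the top coefficient of [b] that survives in [R]. If [phi] does not kill it, the
    image of [b] is a nonzero polynomial over [k], and [x] can be sent to any of its nonroots. *)
Lemma extend_transcendental (b : {poly A}) :
  (forall h, jx h = 0 -> map_poly j h = 0) -> jx b != 0 ->
  exists2 a, j a != 0 & forall phi : {rmorphism A -> k},
    factors_through j phi -> phi a != 0 ->
    exists psi : {rmorphism {poly A} -> k},
      [/\ factors_through jx psi, forall c, psi c%:P = phi c & psi b != 0].
Proof.
move=> tx b0; pose n := (size (map_poly j b)).-1.
have jb0 : map_poly j b != 0.
  by apply: contraNneq b0 => jb; rewrite adjoinE jb horner0.
exists b`_n; first by rewrite -coef_map -lead_coefE lead_coef_eq0.
move=> phi jphi phib.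
have : map_poly phi b != 0.
  by apply: contraNneq phib => phib0; rewrite -coef_map phib0 coef0.
case/closed_nonrootP => t nt; exists (adjoin phi t); split=> //.
  move=> h /tx jh; rewrite /= adjoinE.
  have -> : map_poly phi h = 0; last by rewrite horner0.
  apply/polyP => m; rewrite coef_map coef0; apply: jphi.
  by rewrite -coef_map jh coef0.
by move=> c; rewrite /= adjoinC.
Qed.

(* [q] is a relation of least degree for [x]; up to a power of its leading
   coefficient it divides every other relation, so [x] may be sent to any root
   of the image of [q]. [e] is a multiple of [b] in [A[x]] of least degree; it
   has degree 0, as otherwise dividing [q] by [e] would lower one of the two
   degrees. *)
Lemma extend_algebraic (b q0 : {poly A}) :
  jx q0 = 0 -> map_poly j q0 != 0 -> jx b != 0 ->
  exists2 a, j a != 0 & forall phi : {rmorphism A -> k},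
    factors_through j phi -> phi a != 0 ->
    exists psi : {rmorphism {poly A} -> k},
      [/\ factors_through jx psi, forall c, psi c%:P = phi c & psi b != 0].
Proof.
move=> q00 jq0 b0.
pose Pq h := jx h = 0 /\ map_poly j h != 0.
have [|q [qx jq] minq] := @ex_min_size A Pq; first by exists q0.
have q0' : q != 0 by apply: contraNneq jq => ->; rewrite rmorph0.
have sq : size (map_poly j q) = size q.
  by apply: (@size_map_min Pq) => // h r; rewrite /Pq !adjoinE => ->.
have lq := size_map_lead q0' sq.
have relq h : jx h = 0 -> (size (map_poly j h) < size q)%N -> map_poly j h = 0.
  move=> hx sh; apply/eqP; apply: contraLR sh => jh; rewrite -leqNgt.
  apply: leq_trans (size_take_poly (size (map_poly j h)) h).
  by apply: minq; rewrite /Pq adjoin_take map_poly_take.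
pose Pe h := jx h != 0 /\ exists g, jx h = jx b * jx g.
have [|e Pee mine] := @ex_min_size A Pe.
  by exists b; split=> //; exists 1; rewrite rmorph1 mulr1.
have [ex [g eg]] := Pee.
have e0 : e != 0 by apply: contraNneq ex => ->; rewrite rmorph0.
have se : size (map_poly j e) = size e.
  by apply: (@size_map_min Pe) => // h r; rewrite /Pe !adjoinE => ->.
have le := size_map_lead e0 se.
(* Pseudo-division of [b] by [q]: since [q] vanishes at [x], the remainder has the value of a power
   of [lead_coef q] times [b], so it competes with [e]. *)
have seq : (size e < size q)%N.
  have := Pdiv.ComRing.rdivp_eq q b.
  set m := Pdiv.Ring.rscalp _ _; set s := Pdiv.Ring.rdivp _ _.
  set r := Pdiv.Ring.rmodp _ _ => /(congr1 jx).
  rewrite adjoinZ rmorphD rmorphM /= qx mulr0 add0r rmorphXn => rx.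
  apply: leq_ltn_trans (_ : size r < size q)%N; last first.
    by rewrite Pdiv.CommonRing.ltn_rmodp.
  apply: mine; split; first by rewrite -rx mulf_neq0 // expf_neq0.
  exists (lead_coef q ^+ m)%:P.
  by rewrite adjoinC rmorphXn mulrC rx.
(* Otherwise pseudo-divide [q] by [e]. The value of the remainder [r] is a multiple of that of [b],
   so minimality of [e] makes [r] a relation, and then [s] is one too. Both are shorter than [q]
   over [R], so they vanish there, and so would [q]. *)
have se1 : size e = 1%N.
  apply/eqP; rewrite eqn_leq lt0n size_poly_eq0 e0 andbT leqNgt.
  apply/negP => e1.
  have := Pdiv.ComRing.rdivp_eq e q.
  set m := Pdiv.Ring.rscalp _ _; set s := Pdiv.Ring.rdivp _ _.
  set r := Pdiv.Ring.rmodp _ _ => E.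
  have sr : (size r < size e)%N by rewrite Pdiv.CommonRing.ltn_rmodp.
  have rx : jx r = 0.
    apply/eqP; apply: contraLR sr => rx; rewrite -leqNgt; apply: mine.
    split=> //; exists (- (s * g)); move/(congr1 jx): E.
    rewrite adjoinZ qx mulr0 rmorphD rmorphM /= eg => /eqP.
    rewrite eq_sym addrC addr_eq0 => /eqP ->.
    by rewrite rmorphN rmorphM /= mulrN mulrCA.
  have sx : jx s = 0.
    move/(congr1 jx): E; rewrite adjoinZ qx mulr0 rmorphD rmorphM /= rx addr0.
    by move/esym/eqP; rewrite mulf_eq0 (negPf ex) orbF => /eqP.
  have jr : map_poly j r = 0.
    apply: relq => //; apply: leq_ltn_trans (size_poly _ _) _.
    exact: ltn_trans seq.
  move/(congr1 (map_poly j)): E; rewrite rmorphD rmorphM /= jr addr0.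
  rewrite map_polyZ rmorphXn => E.
  have l0 : j (lead_coef e) ^+ m != 0 by rewrite expf_neq0.
  have sE := congr1 (fun p : {poly R} => size p) E.
  move: sE; rewrite size_scale // sq => sE.
  have js : map_poly j s != 0.
    apply: contraNneq q0' => js.
    by rewrite -size_poly_eq0 sE js mul0r size_poly0.
  have je : map_poly j e != 0 by rewrite -size_poly_eq0 se size_poly_eq0.
  apply: (negP js); apply/eqP/relq => //.
  rewrite sE size_mul // se -ltnS prednK ?addn_gt0 ?size_poly_gt0 ?js //.
  by rewrite -addn2 leq_add2l.
have [c ec c0] : exists2 c, e = c%:P & j c != 0.
  exists e`_0; first by apply: size1_polyC; rewrite se1.
  by move: le; rewrite lead_coefE se1.
(* The first factor keeps the degree of [q] under [phi], which provides a root; the second keeps the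
   image of [b] nonzero. *)
exists (lead_coef q * c); first by rewrite rmorphM mulf_neq0.
move=> phi jphi; rewrite rmorphM mulf_eq0 negb_or => /andP[phiq phic].
have sphiq : size (map_poly phi q) = size q by apply: size_map_poly_id0.
(* A constant relation would have its leading coefficient killed by [j]. *)
have : size (map_poly phi q) != 1%N.
  rewrite sphiq; apply/negP => /eqP sq1; move/eqP: qx.
  rewrite [q]size1_polyC ?sq1 // adjoinC; apply/negP.
  by move: lq; rewrite lead_coefE sq1.
case/closed_rootP => t /rootP tq.
(* Modulo [q], a power of the leading coefficient times any relation [h] leaves a relation shorter
   than [q], whose coefficients are killed by [j] and hence by [phi]. *)
have Fpsi : factors_through jx (adjoin phi t).
  move=> h hx; have := Pdiv.ComRing.rdivp_eq q h.
  set m := Pdiv.Ring.rscalp _ _; set s := Pdiv.Ring.rdivp _ _.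
  set r := Pdiv.Ring.rmodp _ _ => E.
  have rx : jx r = 0.
    move/(congr1 jx): E; rewrite adjoinZ hx mulr0 rmorphD rmorphM /= qx.
    by rewrite mulr0 add0r.
  have jr : map_poly j r = 0.
    apply: relq => //; apply: leq_ltn_trans (size_poly _ _) _.
    by rewrite Pdiv.CommonRing.ltn_rmodp.
  have phir : map_poly phi r = 0.
    apply/polyP => n; rewrite coef_map coef0; apply: jphi.
    by rewrite -coef_map jr coef0.
  move/(congr1 (adjoin phi t)): E; rewrite adjoinZ rmorphD rmorphM /=.
  rewrite [adjoin phi t q]adjoinE tq mulr0 add0r [adjoin phi t r]adjoinE phir.
  rewrite horner0 rmorphXn => /eqP; rewrite mulf_eq0 expf_eq0 (negPf phiq).
  by rewrite andbF => /eqP.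
exists (adjoin phi t); split=> // [a|]; first by rewrite /= adjoinC.
(* The relation [e = b * g] is preserved, so the image of [b] divides [phi c], which is nonzero. *)
have /Fpsi/eqP : jx (e - b * g) = 0 by rewrite rmorphB rmorphM /= eg subrr.
rewrite rmorphB rmorphM /= ec adjoinC subr_eq0 => /eqP phicE.
by apply: contraNneq phic => pb; rewrite phicE pb mul0r.
Qed.

Lemma extend_adjoin (b : {poly A}) : jx b != 0 ->
  exists2 a, j a != 0 & forall phi : {rmorphism A -> k},
    factors_through j phi -> phi a != 0 ->
    exists psi : {rmorphism {poly A} -> k},
      [/\ factors_through jx psi, forall c, psi c%:P = phi c & psi b != 0].
Proof.
have [tx|/existsNP[q /not_implyP[qx /eqP jq]]] :=
  pselect (forall h, jx h = 0 -> map_poly j h = 0).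
  exact: extend_transcendental.
exact: extend_algebraic jq.
Qed.

End Step.

(** Induction on the generators: the element [b] of [A[x]] that must survive for the remaining ones
    is handed to [extend_adjoin], which trades it for an element [a] of [A]. *)
Lemma extend_adjoin_seq (xs : seq R) (A : comNzRingType)
    (j : {rmorphism A -> R}) :
  exists2 a, j a != 0 & forall phi : {rmorphism A -> k},
    factors_through j phi -> phi a != 0 ->
    exists (B : comNzRingType) (g : {rmorphism A -> B})
        (jB : {rmorphism B -> R}) (psi : {rmorphism B -> k}),
      [/\ factors_through jB psi, jB \o g =1 j, psi \o g =1 phi &
          forall x, x \in xs -> exists y, jB y = x].
Proof.
elim: xs A j => [|x xs IH] A j.
  exists 1; first by rewrite rmorph1 oner_neq0.
  by move=> phi jphi _; exists A, idfun, j, phi.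
have [b b0 bP] := IH _ (adjoin j x).
have [a a0 aP] := extend_adjoin b0; exists a => // phi jphi phia.
have [psi [jpsi psiC psib]] := aP phi jphi phia.
have [B [g [jB [chi [jchi jBg chig xsB]]]]] := bP psi jpsi psib.
exists B, (g \o polyC), jB, chi; split=> //.
- by move=> y /=; rewrite -[LHS]/((jB \o g) y%:P) jBg /= adjoinC.
- by move=> y /=; rewrite -[LHS]/((chi \o g) y%:P) chig psiC.
- move=> y; rewrite inE => /predU1P[->|]; last exact: xsB.
  by exists (g 'X); rewrite -[LHS]/((jB \o g) 'X) jBg /= adjoinX.
Qed.

Variable i : {rmorphism k -> R}.

(** Over an algebraically closed field [h] splits, and no linear factor ['X - z] vanishes at [u]. *)
Lemma adjoin_transcendental (u : R) : (forall c, u != i c) ->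
  forall h, adjoin i u h = 0 -> h = 0.
Proof.
move=> nu h; have [rs ->] := closed_field_poly_normal h.
rewrite adjoinZ rmorph_prod /= => /eqP; rewrite mulf_eq0 fmorph_eq0.
case/orP => [/eqP -> //|]; first by rewrite scale0r.
rewrite prodf_seq_eq0 => /hasP[z _ /=].
by rewrite rmorphB /= adjoinX adjoinC subr_eq0 (negPf (nu z)).
Qed.

Lemma sub_scal_nonunit (u : R) : finitely_generated i -> (forall c, u != i c) ->
  exists2 a : {poly k}, a != 0 &
    forall c, a.[c] != 0 -> u - i c \isn't a GRing.unit.
Proof.
move=> [xs xsP] nu.
have [a a0 aP] := extend_adjoin_seq xs (adjoin i u).
exists a; first by apply: contraNneq a0 => ->; rewrite rmorph0.
move=> c ac; apply/negP => /unitrPr[v uv].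
(* Evaluation at [c]; its extension to [R] would send [u - i c] to 0, which is impossible for a
   unit. *)
pose phi : {rmorphism {poly k} -> k} := adjoin (idfun : {rmorphism k -> k}) c.
have phiE h : phi h = h.[c] by rewrite /phi /= adjoinE map_poly_id.
have [||B [g [jB [psi [jpsi jBg psig xsB]]]]] := aP phi.
- by move=> h /(adjoin_transcendental nu) ->; rewrite rmorph0.
- by rewrite phiE.
(* The image of [jB] is a subring that contains the scalars and the generators of [R]. *)
have surj y : exists z, jB z = y.
  apply/asboolP; apply: (xsP [pred y | `[< exists z, jB z = y >]]).
  - split=> [|_ _ /asboolP[z <-] /asboolP[w <-]
             |_ _ /asboolP[z <-] /asboolP[w <-]].
    + by apply/asboolP; exists 1; rewrite rmorph1.
    + by apply/asboolP; exists (z - w); rewrite rmorphB.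
    + by apply/asboolP; exists (z * w); rewrite rmorphM.
  - move=> d; apply/asboolP; exists (g d%:P).
    by rewrite -[LHS]/((jB \o g) d%:P) jBg /= adjoinC.
  - by move=> z /xsB ?; apply/asboolP.
have [w wv] := surj v.
have /jpsi/eqP : jB (g ('X - c%:P) * w - 1) = 0.
  rewrite rmorphB rmorph1 rmorphM wv -[jB (g _)]/((jB \o g) _) jBg.
  by rewrite rmorphB /= adjoinX adjoinC uv subrr.
rewrite rmorphB rmorph1 rmorphM -[psi (g _)]/((psi \o g) _) psig phiE.
by rewrite hornerXsubC subrr mul0r sub0r oppr_eq0 oner_eq0.
Qed.

Lemma finite_unit_sub_scal (u : R) : finitely_generated i ->
  (forall c, u != i c) -> finite_set [set c | u - i c \is a GRing.unit].
Proof.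
move=> fgR nu; have [a a0 aP] := sub_scal_nonunit fgR nu.
have [rs aE] := closed_field_poly_normal a.
apply: (@sub_finite_set _ _ [set` rs]); last exact: finite_seq.
(* The exceptional scalars are all roots of the nonzero polynomial [a]. *)
move=> c /= uc; have : root a c.
  by apply: contraLR uc => /aP.
rewrite aE rootZ ?lead_coef_eq0 // root_prod_XsubC //.
Qed.

Lemma unit_additive_scal (u : R) : finitely_generated i -> unit_additive R ->
  u \is a GRing.unit -> exists c, u = i c.
Proof.
move=> fgR uaR Uu; apply: contrapT => nu.
have {}nu c : u != i c by apply/eqP => uc; apply: nu; exists c.
have [a a0 aP] := sub_scal_nonunit fgR nu.
(* The factor ['X] forces [c] to be nonzero, so that [i (- c)] is a unit; yet [u - i c] is neither a
   unit nor nilpotent. *)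
have : a * 'X != 0 by rewrite mulf_neq0 // polyX_eq0.
case/closed_nonrootP => c; rewrite rootM rootX negb_or => /andP[ac c0].
have Uc : i (- c) \is a GRing.unit by rewrite rmorph_unit // unitfE oppr_eq0.
have [|[n /eqP]] := uaR _ _ Uu Uc.
  by rewrite rmorphN (negPf (aP _ ac)).
by rewrite expf_eq0 rmorphN subr_eq0 (negPf (nu c)) andbF.
Qed.

End Specialization.

(** * Prime ideals and global sections *)

Section PrimeIdeals.
Variable R : comNzRingType.

Definition mk_prime (S : {pred R}) (idS : idealr_closed S)
    (primeS : prime_idealr_closed S) : spec R :=
  HB.pack_for (prime_idealr R) S (isIdealr.Build R S idS)
    (isPrimeIdealrClosed.Build R S primeS).

Lemma spec_eqP (p q : spec R) :
  (p : prime_idealr R) =i (q : prime_idealr R) -> p = q.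
Proof.
case: p q => [S [[p1] [p2] [p3] [p4]]] [T [[q1] [q2] [q3] [q4]]] ST.
have {}ST : S = T by apply/funext => x; exact: ST.
subst T.
by rewrite (Prop_irrelevance p1 q1) (Prop_irrelevance p2 q2)
  (Prop_irrelevance p3 q3) (Prop_irrelevance p4 q4).
Qed.

(** Zorn's lemma gives an ideal maximal among the proper ones containing [I], and a maximal ideal is
    prime. *)
Lemma ideal_sub_prime (I : set R) :
  I 0 -> (forall a b, I a -> I b -> I (a + b)) ->
  (forall r a, I a -> I (r * a)) -> ~ I 1 ->
  exists p : spec R, forall a, I a -> a \in (p : prime_idealr R).
Proof.
move=> I0 ID IM I1.
pose P (A : set R) := A = set0 \/ [/\ I `<=` A,
  forall a b, A a -> A b -> A (a + b), forall r a, A a -> A (r * a) & ~ A 1].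
have PI : P I by right; split.
have [F FP totF|M [PM maxM]] := @Zorn_bigcup R P.
  have [F0|/eqP/set0P[x [A FA Ax]]] := pselect (\bigcup_(X in F) X = set0).
    by left.
  have FE B y : F B -> B y -> [/\ I `<=` B, forall a b, B a -> B b -> B (a + b),
      forall r a, B a -> B (r * a) & ~ B 1].
    by move=> /FP[-> []|].
  right; split.
  - by move=> a Ia; exists A => //; have [+ _ _ _] := FE A x FA Ax; apply.
  - move=> a b [B FB Ba] [C FC Cb].
    have [BC|CB] := totF B C FB FC.
      exists C => //; have [_ + _ _] := FE C b FC Cb; apply=> //; exact: BC.
    exists B => //; have [_ + _ _] := FE B a FB Ba; apply=> //; exact: CB.
  - move=> r a [B FB Ba]; exists B => //.
    by have [_ _ + _] := FE B a FB Ba; apply.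
  - by move=> [B FB B1]; have [_ _ _] := FE B 1 FB B1; apply.
have [IM' MD MM M1] : [/\ I `<=` M, forall a b, M a -> M b -> M (a + b),
    forall r a, M a -> M (r * a) & ~ M 1].
  case: PM => // M0; exfalso; apply: maxM PI.
  by rewrite M0; split=> // sI0; exact: (sI0 0 I0).
have idM : idealr_closed [pred x | `[< M x >]].
  split; first by apply/asboolP/IM'.
    by apply/negP => /asboolP.
  by move=> a u v /asboolP Mu /asboolP Mv; apply/asboolP/MD => //; exact: MM.
have primeM : prime_idealr_closed [pred x | `[< M x >]].
  move=> a b /asboolP Mab; apply/orP.
  have [|nMa] := pselect (M a); first by left; apply/asboolP.
  right; apply/asboolP.
  (* The ideal generated by [M] and [a]; by maximality of [M] it contains 1. *)
  pose N := [set x | exists m r, M m /\ x = m + r * a].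
  have MN : M `<` N.
    split=> [x Mx|NM]; first by exists x, 0; rewrite mul0r addr0.
    apply: nMa; apply: NM; exists 0, 1; rewrite mul1r add0r.
    by split=> //; exact: IM'.
  have nPN := maxM _ MN.
  have [m [r [Mm r1]]] : N 1.
    apply: contrapT => N1; apply: nPN; right; split=> //.
    - by move=> x /IM' Mx; exists x, 0; rewrite mul0r addr0.
    - move=> _ _ [m [r [Mm ->]]] [n [s [Mn ->]]]; exists (m + n), (r + s).
      by split; [exact: MD|rewrite mulrDl addrACA].
    - move=> s _ [m [r [Mm ->]]]; exists (s * m), (s * r).
      by split; [exact: MM|rewrite mulrDr mulrA].
  have -> : b = b * m + r * (a * b).
    by rewrite mulrA [b * m]mulrC -mulrDl -r1 mul1r.
  by apply: MD; exact: MM.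
by exists (mk_prime idM primeM) => a Ia; apply/asboolP/IM'.
Qed.

End PrimeIdeals.

Lemma nonunit_sub_prime (R : comUnitRingType) (a : R) :
  a \isn't a GRing.unit -> exists p : spec R, a \in (p : prime_idealr R).
Proof.
move=> nUa; pose I := [set b | exists r, b = r * a].
have [||||p pI] := @ideal_sub_prime R I.
- by exists 0; rewrite mul0r.
- by move=> _ _ [r ->] [s ->]; exists (r + s); rewrite mulrDl.
- by move=> s _ [r ->]; exists (s * r); rewrite mulrA.
- by move=> [r r1]; apply: (negP nUa); apply/unitrPr; exists r; rewrite mulrC.
by exists p; apply: pI; exists 1; rewrite mul1r.
Qed.

Definition zero_point (R : idomainType) : spec R.
Proof.
apply: (@mk_prime R [pred x | x == 0]); last first.
  by move=> a b; rewrite !inE mulf_eq0.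
split; rewrite ?inE ?oner_eq0 //.
by move=> a u v; rewrite !inE => /eqP -> /eqP ->; rewrite mulr0 addr0.
Defined.

Lemma mem_zero_point (R : idomainType) (a : R) :
  (a \in (zero_point R : prime_idealr R)) = (a == 0).
Proof. by []. Qed.

(** The zero ideal is the generic point: an equation that fails at [p] is given by a nonzero
    element, so it fails there too. *)
Lemma zero_point_open (R : idomainType) (U : opens (spec R)) (p : spec R) :
  oset U p -> oset U (zero_point R).
Proof.
case: U => U /= [E ->] /existsNP[a /not_implyP[Ea /negP pa]] /(_ a Ea).
by rewrite mem_zero_point => /eqP a0; rewrite a0 idealr0 in pa.
Qed.

Section GlobalSections.
Variables (R : idomainType) (U : opens (spec R)) (s : spec_sec U).

(** Every local expression [a / b] is also valid at the generic point, so all of them agree. *)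
Lemma spec_sec_cst : exists z, forall p, s p = z.
Proof.
have [[p0]|U0] := pselect (inhabited (oset U)); last first.
  by exists 0 => p; exfalso; apply: U0; exists.
have Z := zero_point_open (set_valP p0).
pose z : oset U := exist _ (zero_point R) (mem_set Z).
exists (s z) => p.
have [V [a [b [Vp sV]]]] := spec_sec_frac s p.
have [_ ->] := sV p Vp; symmetry.
by have [] := sV z (zero_point_open Vp).
Qed.

Lemma global_sec :
  (forall p, oset U p) -> exists r : R, forall p, s p = tofrac r.
Proof.
move=> UT; have [z sz] := spec_sec_cst.
suff [r zr] : exists r : R, z = tofrac r by exists r => p; rewrite sz.
(* The ideal of denominators of [z]. A prime containing it would contain the denominator of a local
   expression of [s] at that very prime. *)
pose I := [set d : R | exists r, tofrac d * z = tofrac r].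
suff : I 1 by move=> [r]; rewrite tofrac1 mul1r; exists r.
apply: contrapT => I1; have [||||p pI] := @ideal_sub_prime R I => //.
- by exists 0; rewrite tofrac0 mul0r.
- by move=> a b [r ar] [q bq]; exists (r + q); rewrite !tofracD mulrDl ar bq.
- by move=> q a [r ar]; exists (q * r); rewrite !tofracM -mulrA ar.
pose q : oset U := exist _ p (mem_set (UT p)).
have [V [a [b [Vp /(_ q Vp)[bp sq]]]]] := spec_sec_frac s q.
apply: (negP bp); apply: pI; exists a.
by rewrite -(sz q) sq mulrC divfK // (nonideal_neq0 bp).
Qed.

End GlobalSections.

(** * Extension of an injective ring morphism to fraction fields *)

Section FracMap.
Variables (A B : idomainType) (j : {rmorphism A -> B}).
Hypothesis j_inj : forall a, j a = 0 -> a = 0.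

Lemma tofrac_surj (D : idomainType) (z : {fraction D}) :
  exists ab : D * D, ab.2 != 0 /\ z = tofrac ab.1 / tofrac ab.2.
Proof.
elim/quotW: z => x; exists (frac x); split; first exact: denom_ratioP.
rewrite -[RHS]/(FracField.mul _ (FracField.inv _)) !piE.
rewrite /FracField.mulf /FracField.invf !numden_Ratio ?oner_eq0
  ?denom_ratioP //.
by rewrite mulr1 mul1r Ratio_numden.
Qed.

(* Independent of the chosen fraction only when [j] is injective. *)
Definition frac_map (z : {fraction A}) : {fraction B} :=
  let ab := projT1 (cid (tofrac_surj z)) in tofrac (j ab.1) / tofrac (j ab.2).

Lemma frac_mapE a b : b != 0 ->
  frac_map (tofrac a / tofrac b) = tofrac (j a) / tofrac (j b).
Proof.
move=> b0; rewrite /frac_map; case: cid => -[c d] /= [d0 E].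
have j0 x : x != 0 -> tofrac (j x) != 0.
  by apply: contra_neq => /eqP; rewrite tofrac_eq0 => /eqP /j_inj.
apply/eqP; rewrite eqr_div ?j0 // -!tofracM -!rmorphM.
by rewrite (frac_eq b0 d0 E).
Qed.

Lemma frac_map_tofrac a : frac_map (tofrac a) = tofrac (j a).
Proof.
by have := frac_mapE a (oner_neq0 _); rewrite !rmorph1 !divr1.
Qed.

Lemma frac_map_zmod : zmod_morphism frac_map.
Proof.
move=> x y.
have [[a b] /= [b0 ->]] := tofrac_surj x.
have [[c d] /= [d0 ->]] := tofrac_surj y.
have j0 z : z != 0 -> tofrac (j z) != 0.
  by apply: contra_neq => /eqP; rewrite tofrac_eq0 => /eqP /j_inj.
rewrite -mulNr addf_div ?tofrac_eq0 // -tofracN -!tofracM -tofracD.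
rewrite !frac_mapE ?mulf_neq0 // -mulNr addf_div ?j0 //.
by rewrite -tofracN -!tofracM -tofracD rmorphD !rmorphM rmorphN.
Qed.

Lemma frac_map_monoid : monoid_morphism frac_map.
Proof.
split; first by rewrite -tofrac1 frac_map_tofrac rmorph1 tofrac1.
move=> x y.
have [[a b] /= [b0 ->]] := tofrac_surj x.
have [[c d] /= [d0 ->]] := tofrac_surj y.
rewrite mulf_div -!tofracM !frac_mapE ?mulf_neq0 // mulf_div -!tofracM.
by rewrite -!rmorphM.
Qed.

End FracMap.

(** The converse of [comor_local] holds for any morphism: a local inverse pulls back to a local
    inverse. *)
Lemma comor_germ_unit (k : comNzRingType) (X Y : lrspace k)
    (f : lrspace_mor X Y) (V : opens Y) (s : sec V) (x : X) :
  germ_unit (@res k Y) s (f x) -> germ_unit (@res k X) (comor f V s) x.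
Proof.
move=> [W [WV [Wfx [t st]]]]; pose c := @mor_continuous _ _ _ f.
have fWV : preim_opens c W `<=` preim_opens c V by move=> y; exact: WV.
exists (preim_opens c W), fWV; split=> //; exists (comor f W t).
by rewrite -comor_res -rmorphM st rmorph1.
Qed.

(** * Values and germs of sections on an affine scheme *)

Section AffineSections.
Variables (k : comNzRingType) (A : idomainType) (i : {rmorphism k -> A}).
Local Notation X := (affine_scheme i).

Definition sec_val (U : opens X) (s : sec U) (p : oset U) : {fraction A} :=
  (s : spec_sec U) p.

Lemma sec_valP (U : opens X) (s t : sec U) :
  (forall p, sec_val s p = sec_val t p) -> s = t.
Proof. exact: spec_secP. Qed.

Lemma sec_valD (U : opens X) (s t : sec U) p :
  sec_val (s + t) p = sec_val s p + sec_val t p.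
Proof. by []. Qed.

Lemma sec_valB (U : opens X) (s t : sec U) p :
  sec_val (s - t) p = sec_val s p - sec_val t p.
Proof. by []. Qed.

Lemma sec_valM (U : opens X) (s t : sec U) p :
  sec_val (s * t) p = sec_val s p * sec_val t p.
Proof. by []. Qed.

Lemma sec_val1 (U : opens X) p : sec_val (1 : sec U) p = 1.
Proof. by []. Qed.

Lemma sec_val_scal (U : opens X) c (p : oset U) :
  sec_val (scal U c) p = tofrac (i c).
Proof. by []. Qed.

Lemma sec_val_res (U V : opens X) (VU : V `<=` U) (s : sec U)
    (p : oset V) (q : oset U) :
  val q = val p -> sec_val (res VU s) p = sec_val s q.
Proof.
move=> qp; rewrite /sec_val; move: (s : spec_sec U) => {}s.
by rewrite /=; congr (spec_fun s _); exact: val_inj.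
Qed.

Lemma sec_val_frac (U : opens X) (s : sec U) (p : oset U) :
  exists (V : opens X) (a b : A), oset V (val p) /\
    forall q : oset U, oset V (val q) ->
      b \notin (val q : prime_idealr A) /\ sec_val s q = tofrac a / tofrac b.
Proof. exact: (spec_sec_frac (s : spec_sec U)). Qed.

Lemma affine_germ_unit (U : opens X) (s : sec U) (p : oset U) :
  germ_unit (@res k X) s (val p) <-> exists a b : A,
    [/\ a \notin (val p : prime_idealr A), b \notin (val p : prime_idealr A) &
        sec_val s p = tofrac a / tofrac b].
Proof. exact: (spec_germ_unit (s : spec_sec U)). Qed.

Lemma affine_germ_unit_tofrac (U : opens X) (s : sec U) (p : oset U) (a : A) :
  sec_val s p = tofrac a ->
  germ_unit (@res k X) s (val p) <-> a \notin (val p : prime_idealr A).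
Proof.
move=> sa; apply: iff_trans (affine_germ_unit s p) _; rewrite sa; split=> [|ap].
  move=> [c [b [cp bp]]]; rewrite -[X in X = _]divr1 -tofrac1 => /frac_eq.
  move=> /(_ (oner_neq0 _) (notin_neq0 bp)); rewrite mulr1 => ab.
  by move: cp; rewrite -ab prime_idealrM negb_or => /andP[].
by exists a, 1; rewrite idealr1 tofrac1 divr1.
Qed.

(** The function defined by an element of [A] is a scalar section once [A] is taken as its own base
    ring. *)
Definition const_sec (U : opens X) (a : A) : sec U :=
  @spec_scal A A idfun U a.

Lemma const_secD U a b : const_sec U (a + b) = const_sec U a + const_sec U b.
Proof. exact: (rmorphD (@spec_scal A A idfun U)). Qed.

Lemma const_secM U a b : const_sec U (a * b) = const_sec U a * const_sec U b.
Proof. exact: (rmorphM (@spec_scal A A idfun U)). Qed.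

Lemma const_sec_res (U V : opens X) (VU : V `<=` U) a :
  res VU (const_sec U a) = const_sec V a.
Proof. exact: spec_secP. Qed.

Lemma sec_val_const U a p : sec_val (const_sec U a) p = tofrac a.
Proof. by []. Qed.

End AffineSections.

(** * Morphisms into an open subscheme of an affine scheme *)

Section Ambient.
Variables (k : comNzRingType) (L : lrspace k) (U : opens L).
Local Notation C := (open_subspace U).

Definition ambient_opens (W : opens C) : opens L := @image_opens k L U W.
Definition trace_sub_opens (W : opens L) : opens C := @trace_opens k L U W.

Lemma mem_ambient (W : opens C) (x : C) :
  oset W x -> oset (ambient_opens W) (set_val x).
Proof. by exists x. Qed.

Lemma ambient_mem (W : opens C) (y : L) :
  oset (ambient_opens W) y -> exists2 x : C, oset W x & set_val x = y.
Proof. by []. Qed.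

Lemma ambient_subset (V W : opens C) :
  W `<=` V -> ambient_opens W `<=` ambient_opens V.
Proof. exact: image_subset. Qed.

(* Both maps are the identity; naming them keeps conversion from unfolding
   [affine_scheme] when the two kinds of sections are compared. *)
Definition to_ambient (W : opens C) (s : sec W) : sec (ambient_opens W) := s.
Definition of_ambient (W : opens C) (s : sec (ambient_opens W)) : sec W := s.

Lemma of_ambientK W : cancel (@of_ambient W) (@to_ambient W).
Proof. by []. Qed.

Lemma to_ambientK W : cancel (@to_ambient W) (@of_ambient W).
Proof. by []. Qed.

Lemma to_ambientD W (s t : sec W) :
  to_ambient (s + t) = to_ambient s + to_ambient t.
Proof. by []. Qed.

Lemma to_ambientB W (s t : sec W) :
  to_ambient (s - t) = to_ambient s - to_ambient t.
Proof. by []. Qed.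

Lemma to_ambientM W (s t : sec W) :
  to_ambient (s * t) = to_ambient s * to_ambient t.
Proof. by []. Qed.

Lemma to_ambient1 W : to_ambient (1 : sec W) = 1.
Proof. by []. Qed.

Lemma to_ambient_scal W c : to_ambient (scal W c) = scal _ c.
Proof. by []. Qed.

Lemma to_ambient_res (V W : opens C) (WV : W `<=` V) (s : sec V) :
  to_ambient (res WV s) = res (ambient_subset WV) (to_ambient s).
Proof.
by rewrite (Prop_irrelevance (ambient_subset WV) (image_subset _ WV)).
Qed.

Lemma to_ambient_germ (W : opens C) (s : sec W) (x : C) :
  germ_unit (@res k C) s x <-> germ_unit (@res k L) (to_ambient s) (set_val x).
Proof. exact: open_germ_unit. Qed.

End Ambient.

Section Morphisms.
Variables (k : comNzRingType) (A R : idomainType).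
Variables (iA : {rmorphism k -> A}) (i : {rmorphism k -> R}).
Local Notation X := (affine_scheme i).
Local Notation S := (affine_scheme iA).
Variable D : opens S.
Local Notation C := (open_subspace D).

Definition cst_sec (W : opens C) (h : A) : sec W :=
  of_ambient (const_sec (ambient_opens W) h).

Definition open_val (W : opens C) (s : sec W) (p : oset (ambient_opens W)) :
    {fraction A} :=
  sec_val (to_ambient s) p.

Lemma open_valB W (s t : sec W) p :
  open_val (s - t) p = open_val s p - open_val t p.
Proof. by rewrite /open_val to_ambientB sec_valB. Qed.

Lemma open_valM W (s t : sec W) p :
  open_val (s * t) p = open_val s p * open_val t p.
Proof. by rewrite /open_val to_ambientM sec_valM. Qed.

Lemma open_val1 W p : open_val (1 : sec W) p = 1.
Proof. by rewrite /open_val to_ambient1 sec_val1. Qed.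

Lemma open_val_scal W c p : open_val (scal W c) p = tofrac (iA c).
Proof. by rewrite /open_val to_ambient_scal sec_val_scal. Qed.

Lemma open_val_cst W h p : open_val (cst_sec W h) p = tofrac h.
Proof. by rewrite /open_val of_ambientK sec_val_const. Qed.

Lemma open_valP W (s t : sec W) :
  (forall p, open_val s p = open_val t p) -> s = t.
Proof. by move=> st; apply/(can_inj (@to_ambientK _ _ _ W))/sec_valP. Qed.

Lemma cst_secD W a b : cst_sec W (a + b) = cst_sec W a + cst_sec W b.
Proof.
apply: (can_inj (@to_ambientK _ _ _ W)).
by rewrite to_ambientD !of_ambientK const_secD.
Qed.

Lemma cst_secM W a b : cst_sec W (a * b) = cst_sec W a * cst_sec W b.
Proof.
apply: (can_inj (@to_ambientK _ _ _ W)).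
by rewrite to_ambientM !of_ambientK const_secM.
Qed.

Lemma cst_sec_scal W c : cst_sec W (iA c) = scal W c.
Proof.
apply: open_valP => p.
exact: etrans (open_val_cst (iA c) p) (esym (open_val_scal c p)).
Qed.

Lemma cst_sec_res (V W : opens C) (WV : W `<=` V) h :
  res WV (cst_sec V h) = cst_sec W h.
Proof.
apply: (can_inj (@to_ambientK _ _ _ W)); rewrite to_ambient_res.
exact: const_sec_res.
Qed.

Lemma open_val_res (V W : opens C) (WV : W `<=` V) (s : sec V) p q :
  val q = val p -> open_val (res WV s) p = open_val s q.
Proof. by rewrite /open_val to_ambient_res; exact: sec_val_res. Qed.

Lemma open_val_frac (W : opens C) (s : sec W) (p : oset (ambient_opens W)) :
  exists (V : opens S) (a b : A), oset V (val p) /\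
    forall q : oset (ambient_opens W), oset V (val q) ->
      b \notin (val q : prime_idealr A) /\ open_val s q = tofrac a / tofrac b.
Proof. exact: (sec_val_frac (to_ambient s)). Qed.

Lemma subspace_germ_unit (W : opens C) (s : sec W)
    (p : oset (ambient_opens W)) (x : C) : set_val x = val p ->
  germ_unit (@res k C) s x <-> exists a b : A,
    [/\ a \notin (val p : prime_idealr A), b \notin (val p : prime_idealr A) &
        open_val s p = tofrac a / tofrac b].
Proof.
move=> xp; apply: iff_trans (to_ambient_germ s x) _.
by rewrite xp; exact: affine_germ_unit.
Qed.

Lemma cst_sec_germ (W : opens C) (h : A) (x : C) : oset W x ->
  germ_unit (@res k C) (cst_sec W h) x <->
  h \notin (set_val x : prime_idealr A).
Proof.
move=> Wx.
pose q : oset (ambient_opens W) :=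
  exist _ (set_val x) (mem_set (mem_ambient Wx)).
apply: iff_trans (to_ambient_germ _ x) _.
exact: (affine_germ_unit_tofrac (open_val_cst h q)).
Qed.

Definition open_setT (Y : topologicalType) : opens Y := Opens (@openT Y).

(** * Pullback of functions along a morphism *)

Section Pullback.
Variable f : lrspace_mor X C.

Local Notation pre W := (preim_opens (@mor_continuous _ _ _ f) W).

(** The pullback of [h] over the whole target is a global section, hence an element of [R];
    restriction carries it to every [W]. *)
Lemma pullback_exists (h : A) : exists u : R, forall W (p : oset (pre W)),
  sec_val (comor f W (cst_sec W h)) p = tofrac u.
Proof.
pose W0 := open_setT C.
have [//|u uE] := @global_sec _ (pre W0) (comor f W0 (cst_sec W0 h)).
exists u => W p.
have W0W : W `<=` W0 by [].
have fW0W : pre W `<=` pre W0 by [].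
rewrite -(cst_sec_res W0W) (comor_res W0W fW0W).
by rewrite (@sec_val_res _ _ _ _ _ _ _ _ (sub_point fW0W p)) //; exact: uE.
Qed.

Definition pullback (h : A) : R := projT1 (cid (pullback_exists h)).

Lemma pullbackE W h (p : oset (pre W)) :
  sec_val (comor f W (cst_sec W h)) p = tofrac (pullback h).
Proof. by rewrite /pullback; case: cid. Qed.

(** Since [tofrac] is injective, elements of [R] can be compared at a single point. *)
Let zp : oset (pre (open_setT C)) :=
  exist _ (zero_point R) (mem_set (I : oset (pre (open_setT C)) _)).

Lemma pullback_scal c : pullback (iA c) = i c.
Proof.
apply/eqP; rewrite -tofrac_eq -(pullbackE (iA c) zp) cst_sec_scal comor_scal.
by rewrite sec_val_scal.
Qed.

Lemma pullbackD : {morph pullback : a b / a + b}.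
Proof.
move=> a b; apply/eqP; rewrite -tofrac_eq tofracD -!(pullbackE _ zp).
by rewrite cst_secD rmorphD sec_valD.
Qed.

Lemma pullbackM : {morph pullback : a b / a * b}.
Proof.
move=> a b; apply/eqP; rewrite -tofrac_eq tofracM -!(pullbackE _ zp).
by rewrite cst_secM rmorphM sec_valM.
Qed.

Lemma pullback_zmod : zmod_morphism pullback.
Proof.
move=> a b; have := pullbackD (a - b) b; rewrite subrK => ->.
by rewrite addrK.
Qed.

Lemma pullback_monoid : monoid_morphism pullback.
Proof.
split; last exact: pullbackM.
by rewrite -(rmorph1 iA) pullback_scal rmorph1.
Qed.

HB.instance Definition _ :=
  GRing.isZmodMorphism.Build _ _ pullback pullback_zmod.
HB.instance Definition _ :=
  GRing.isMonoidMorphism.Build _ _ pullback pullback_monoid.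

(** Both sides say that a germ is not invertible, that of [h] at [f p] and that of its pullback at
    [p]; locality of [f] makes these equivalent. *)
Lemma mem_mor (p : spec R) (h : A) :
  (h \in (set_val (f p) : prime_idealr A)) =
  (pullback h \in (p : prime_idealr R)).
Proof.
pose W0 := open_setT C.
pose q : oset (pre W0) := exist _ p (mem_set (I : oset (pre W0) p)).
have E := affine_germ_unit_tofrac (pullbackE h q).
have hE : h \notin (set_val (f p) : prime_idealr A) <->
    pullback h \notin (p : prime_idealr R).
  apply: iff_trans (iff_sym (@cst_sec_germ W0 h (f p) I)) _.
  split=> [/comor_germ_unit/E //|hp].
  by apply: (@comor_local _ _ _ f) => //; apply/E.
by apply/idP/idP => [hf|hp]; apply: contraTT isT => /hE; rewrite ?hf ?hp.
Qed.

End Pullback.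
End Morphisms.

Lemma pullback_unit (k : comNzRingType) (A R : idomainType)
    (iA : {rmorphism k -> A}) (i : {rmorphism k -> R}) (g : A)
    (f : lrspace_mor (affine_scheme i)
           (open_subspace (basic_open g : opens (affine_scheme iA)))) :
  pullback f g \is a GRing.unit.
Proof.
apply: contrapT => /negP /nonunit_sub_prime[p]; rewrite -mem_mor.
by have /negP := set_valP (f p).
Qed.

(** For [h] nonzero, the locus where [h] does not vanish contains the generic point, so it meets the
    image; but a function with zero pullback vanishes on the whole image. *)
Lemma dominant_pullback_inj (k : comNzRingType) (A R : idomainType)
    (iA : {rmorphism k -> A}) (i : {rmorphism k -> R})
    (D : opens (affine_scheme iA))
    (f : lrspace_mor (affine_scheme i) (open_subspace D)) :
  oset D (zero_point A) -> dominant_mor f ->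
  forall h, pullback f h = 0 -> h = 0.
Proof.
move=> D0 df h fh; apply/eqP; apply: contrapT => h0.
pose O := trace_sub_opens D (basic_open h : opens (affine_scheme iA)).
have [] := df O _ (oset_open O).
  by exists (exist _ (zero_point A) (mem_set D0)); apply/negP.
move=> y [Oy [p _ fp]]; move: Oy; rewrite -fp => /negP; apply.
by rewrite mem_mor fh idealr0.
Qed.

(** * Constant morphisms over a field *)

Section OverField.
Variables (k : fieldType) (R : idomainType) (i : {rmorphism k -> R}).

Lemma scal_mem_prime (c : k) (p : spec R) :
  (i c \in (p : prime_idealr R)) = (c == 0).
Proof.
have [->|c0] := eqVneq; first by rewrite rmorph0 idealr0.
apply/negP => cp; have := idealr1 p; rewrite -(rmorph1 i) -(divff c0) rmorphM.
by rewrite mulrC idealMr.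
Qed.

Lemma constant_pullback (A : idomainType) (iA : {rmorphism k -> A})
    (D : opens (affine_scheme iA))
    (f : lrspace_mor (affine_scheme i) (open_subspace D))
    (e : {rmorphism A -> k}) :
  (forall h, pullback f h = i (e h)) -> constant_mor f.
Proof.
move=> fe; pose y := f (zero_point R).
have memf p h : (h \in (set_val (f p) : prime_idealr A)) = (e h == 0).
  by rewrite mem_mor fe scal_mem_prime.
have fy x : f x = y.
  by apply: val_inj; apply: spec_eqP => h; rewrite !memf.
split=> [|V s]; first by exists y.
have [Vy|nVy] := pselect (oset V y); last first.
  (* The preimage of [V] is empty here, so any scalar will do. *)
  exists 0; apply: sec_valP => p; exfalso; apply: nVy.
  by rewrite -(fy (val p)); exact: (set_valP p).
pose q : oset (ambient_opens V) :=
  exist _ (set_val y) (mem_set (mem_ambient Vy)).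
have [W [a [b [Wy sW]]]] := open_val_frac s q.
pose W' : opens (open_subspace D) :=
  Opens (openI (oset_open V) (oset_open (trace_sub_opens D W))).
have W'V : W' `<=` V by move=> ? [].
(* Near [y] the section is [a / b]; clearing the denominator leaves constant sections, whose
   pullbacks are known. *)
have sE : cst_sec W' b * res W'V s = cst_sec W' a.
  apply: open_valP => p.
  have [z [Vz Wz] zp] := ambient_mem (set_valP p).
  have Wp : oset W (val p) by rewrite -zp.
  have Vp : oset (ambient_opens V) (val p) by rewrite -zp; exact: mem_ambient.
  pose p' : oset (ambient_opens V) := exist _ (val p) (mem_set Vp).
  have [bp sp] := sW p' Wp.
  rewrite open_valM !open_val_cst (open_val_res W'V s (q := p')) //.
  by rewrite sp mulrC divfK // (nonideal_neq0 bp).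
have eb : e b != 0 by have [+ _] := sW q Wy; rewrite memf.
pose c := @mor_continuous _ _ _ f.
have fWV : preim_opens c W' `<=` preim_opens c V by move=> p; exact: W'V.
exists (e a / e b); apply: sec_valP => p.
have W'p : oset (preim_opens c W') (val p).
  have Vp : oset V y by [].
  by rewrite -[oset _ _]/(oset W' (f (val p))) fy.
pose p' : oset (preim_opens c W') := exist _ (val p) (mem_set W'p).
have := congr1 (fun t => sec_val t p') (congr1 (comor f W') sE).
rewrite rmorphM sec_valM !pullbackE (comor_res W'V fWV) !fe.
rewrite (sec_val_res fWV _ (q := p)) // sec_val_scal => E.
have ib : tofrac (i (e b)) != 0 by rewrite tofrac_eq0 fmorph_eq0.
apply: (mulfI ib).
by rewrite E -tofracM -rmorphM mulrCA mulfV // mulr1.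
Qed.

End OverField.

(** * The morphism attached to an injective ring morphism *)

Section Contraction.
Variables (A R : idomainType) (gam : {rmorphism A -> R}).

Definition contract (p : spec R) : spec A.
Proof.
apply: (@mk_prime A [pred h | gam h \in (p : prime_idealr R)]); last first.
  by move=> a b; rewrite !inE rmorphM prime_idealrM.
split; rewrite ?inE ?rmorph0 ?rmorph1 ?idealr0 ?idealr1 //.
by move=> a b c; rewrite !inE rmorphD rmorphM => jb jc; rewrite rpredD ?idealMr.
Defined.

Lemma mem_contract p h :
  (h \in (contract p : prime_idealr A)) = (gam h \in (p : prime_idealr R)).
Proof. by []. Qed.

Lemma contract_open (W : opens (spec A)) : open (contract @^-1` W).
Proof.
have [E WE] := oset_open W; rewrite WE.
exists (gam @` E); apply/seteqP; split=> p /=.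
  move=> nE jE; apply: nE => a Ea; rewrite mem_contract; apply: jE.
  by exists a.
by move=> nE jE; apply: nE => _ [a Ea <-]; exact: jE.
Qed.

End Contraction.

Section Construction.
Variables (k : comNzRingType) (A R : idomainType).
Variables (iA : {rmorphism k -> A}) (i : {rmorphism k -> R}).
Local Notation X := (affine_scheme i).
Local Notation S := (affine_scheme iA).
Variables (D : opens S) (gam : {rmorphism A -> R}).
Hypothesis gam_inj : forall h, gam h = 0 -> h = 0.
Hypothesis gam_scal : forall c, gam (iA c) = i c.
Hypothesis contractD : forall p, oset D (contract gam p).
Local Notation C := (open_subspace D).

Definition contract_sub (p : X) : C :=
  exist _ (contract gam p) (mem_set (contractD p)).

Lemma contract_sub_continuous : continuous contract_sub.
Proof.
apply/continuousP => _ [W oW <-]; exact: (contract_open gam (Opens oW)).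
Qed.

Local Notation pre W := (preim_opens contract_sub_continuous W).

Lemma ambient_contract (V : opens C) (p : oset (pre V)) :
  oset (ambient_opens V) (contract gam (val p)).
Proof. exact: (mem_ambient (set_valP p)). Qed.

Definition contract_pt (V : opens C) (p : oset (pre V)) :
    oset (ambient_opens V) :=
  exist _ (contract gam (val p)) (mem_set (ambient_contract p)).

(** A local expression [a / b] near the contraction of [p] becomes [gam a / gam b] near [p]; [b]
    avoids the contraction of a prime exactly when [gam b] avoids the prime. *)
Lemma contract_comor_subproof (V : opens C) (s : sec V) :
  `[< locally_fraction (fun p : oset (pre V) =>
        frac_map gam (open_val s (contract_pt p))) >].
Proof.
apply/asboolP => p; have [W [a [b [Wp sW]]]] := open_val_frac s (contract_pt p).
exists (Opens (contract_open gam W)), (gam a), (gam b); split=> // q Wq.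
have [bq ->] := sW (contract_pt q) Wq.
by rewrite (frac_mapE gam_inj) // (notin_neq0 bq).
Qed.

Definition contract_comor (V : opens C) (s : sec V) : sec (pre V) :=
  SpecSec (contract_comor_subproof s).

Lemma contract_comorE V (s : sec V) p :
  sec_val (contract_comor s) p = frac_map gam (open_val s (contract_pt p)).
Proof. by []. Qed.

Lemma contract_comor_zmod V : zmod_morphism (@contract_comor V).
Proof.
move=> s t; apply: sec_valP => p.
rewrite sec_valB !contract_comorE open_valB.
exact: (frac_map_zmod gam_inj).
Qed.

Lemma contract_comor_monoid V : monoid_morphism (@contract_comor V).
Proof.
have [f1 fM] := frac_map_monoid gam_inj.
split=> [|s t]; apply: sec_valP => p.
  by rewrite sec_val1 !contract_comorE open_val1 f1.
by rewrite sec_valM !contract_comorE open_valM fM.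
Qed.

HB.instance Definition _ V :=
  GRing.isZmodMorphism.Build (sec V) (sec (pre V)) (@contract_comor V)
    (@contract_comor_zmod V).
HB.instance Definition _ V :=
  GRing.isMonoidMorphism.Build (sec V) (sec (pre V)) (@contract_comor V)
    (@contract_comor_monoid V).

Lemma contract_comor_res (V W : opens C) (WV : W `<=` V)
    (fWV : pre W `<=` pre V) s :
  contract_comor (res WV s) = res fWV (contract_comor s).
Proof.
apply: sec_valP => p.
rewrite (sec_val_res fWV _ (q := sub_point fWV p)) // !contract_comorE.
by rewrite (open_val_res WV s (q := contract_pt (sub_point fWV p))).
Qed.

Lemma contract_comor_scal (V : opens C) a :
  contract_comor (scal V a) = scal (pre V) a.
Proof.
apply: sec_valP => p; rewrite contract_comorE open_val_scal sec_val_scal.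
by rewrite (frac_map_tofrac gam_inj) gam_scal.
Qed.

Lemma contract_comor_local (V : opens C) (s : sec V) (x : X) :
  oset V (contract_sub x) -> germ_unit (@res k X) (contract_comor s) x ->
  germ_unit (@res k C) s (contract_sub x).
Proof.
move=> Vx; pose p : oset (pre V) := exist _ x (mem_set (Vx : oset (pre V) x)).
move=> /(affine_germ_unit _ p)[a [b [ap bp]]]; rewrite contract_comorE.
have [W [c [d [Wp /(_ _ Wp)[dp sp]]]]] := open_val_frac s (contract_pt p).
rewrite sp (frac_mapE gam_inj) ?(notin_neq0 dp) // => E.
apply/(@subspace_germ_unit _ _ _ _ _ s (contract_pt p)) => //.
exists c, d; split=> //; rewrite mem_contract.
have gd : gam d != 0.
  by apply: contra_neq (notin_neq0 dp); exact: gam_inj.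
(* Cross-multiplication gives [gam c * b = a * gam d], and neither factor on the right lies in
   [x]. *)
have : gam c * b \notin (x : prime_idealr R).
  by rewrite (frac_eq gd (notin_neq0 bp) E) prime_idealrM negb_or ap.
by rewrite prime_idealrM negb_or => /andP[].
Qed.

Definition contract_mor : lrspace_mor X C :=
  @LRSpaceMor k X C contract_sub contract_sub_continuous
    (fun V => @contract_comor V : {rmorphism sec V -> sec (pre V)})
    contract_comor_res contract_comor_scal contract_comor_local.

(** By injectivity the generic point contracts to the generic point, which lies in every nonempty
    open set. *)
Lemma contract_mor_dominant : dominant_mor contract_mor.
Proof.
move=> O [y Oy] [W oW WO].
have contract0 : contract gam (zero_point R) = zero_point A.
  apply: spec_eqP => h; rewrite mem_contract !mem_zero_point.
  by apply/eqP/eqP => [/gam_inj //|->]; rewrite rmorph0.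
exists (contract_mor (zero_point R)); split; last by exists (zero_point R).
rewrite -WO in Oy *.
suff: W (contract gam (zero_point R)) by []; rewrite contract0.
exact: (@zero_point_open A (Opens oW) (val y)).
Qed.

End Construction.

(** * The punctured line *)

Section ClosedPoints.
Variable k : closedFieldType.
Local Notation polyCr := (polyC : {rmorphism k -> {poly k}}).

Definition eval_point (c : k) : spec {poly k}.
Proof.
apply: (@mk_prime {poly k} [pred h | h.[c] == 0]); last first.
  by move=> a b; rewrite !inE hornerM mulf_eq0.
split; rewrite ?inE ?horner0 ?hornerE ?oner_eq0 //.
move=> a u v; rewrite !inE => /eqP u0 /eqP v0.
by rewrite hornerD hornerM u0 v0 mulr0 addr0.
Defined.

Lemma mem_eval_point c (h : {poly k}) :
  (h \in (eval_point c : prime_idealr {poly k})) = (h.[c] == 0).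
Proof. by []. Qed.

(** Modulo ['X - c] a polynomial is congruent to its value at [c], and the only scalar in a prime is
    0. *)
Lemma eval_pointP c (p : spec {poly k}) :
  'X - c%:P \in (p : prime_idealr {poly k}) -> p = eval_point c.
Proof.
move=> pc; apply: spec_eqP => h; rewrite mem_eval_point.
have hc : h - h.[c]%:P \in (p : prime_idealr {poly k}).
  have /factor_theorem[q ->] : root (h - h.[c]%:P) c.
    by rewrite /root !hornerE subrr.
  exact: idealMr.
rewrite -(scal_mem_prime polyCr _ p) -{1}(subrK h.[c]%:P h).
exact: rpredDl.
Qed.

(** A nonzero polynomial in [p] splits into linear factors, one of which lies in [p]. *)
Lemma spec_line (p : spec {poly k}) :
  p = zero_point {poly k} \/ exists c, p = eval_point c.
Proof.
have [[h h0 hp]|nh] :=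
  pselect (exists2 h, h != 0 & h \in (p : prime_idealr {poly k})).
  right; have [rs hE] := closed_field_poly_normal h; move: hp; rewrite hE.
  rewrite -mul_polyC prime_idealrM (scal_mem_prime polyCr).
  rewrite lead_coef_eq0 (negPf h0) /= => {hE}.
  elim: rs => [|c rs IH]; first by rewrite big_nil idealr1.
  rewrite big_cons prime_idealrM => /orP[/eval_pointP ->|//].
  by exists c.
left; apply: spec_eqP => h; rewrite mem_zero_point.
have [->|h0] := eqVneq; first exact: idealr0.
by apply/negP => hp; apply: nh; exists h.
Qed.

Variables (R : idomainType) (i : {rmorphism k -> R}).
Local Notation X := (affine_scheme i).
Local Notation C := (punctured_line k).

Lemma pullback_adjoin (f : lrspace_mor X C) :
  pullback f =1 adjoin i (pullback f 'X).
Proof.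
by apply: adjoin_uniq => // c; exact: (pullback_scal f c).
Qed.

Lemma punctured_line0 : oset (basic_open ('X : {poly k})) (zero_point {poly k}).
Proof. by rewrite /= mem_zero_point polyX_eq0. Qed.

Lemma dominant_cofinite (f : lrspace_mor X C) :
  finitely_generated i -> dominant_mor f -> finite_set (~` range f).
Proof.
move=> fgR df; set u := pullback f 'X.
have nu c : u != i c.
  apply/eqP => uc; have /eqP := polyXsubC_eq0 c; apply.
  apply: (dominant_pullback_inj punctured_line0 df).
  by rewrite pullback_adjoin rmorphB /= adjoinX adjoinC -/u uc subrr.
(* The possible exceptions: a point [c] is attained as soon as some prime contains [u - i c]. The
   generic point is put in [E] without checking whether it is attained. *)
pose E := [set zero_point {poly k}] `|`
  (eval_point @` [set c | u - i c \is a GRing.unit]).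
have finE : finite_set E.
  rewrite finite_setU; split=> //.
  exact/finite_image/finite_unit_sub_scal.
have finE' : finite_set ((fun x : C => set_val x) @^-1` E).
  by apply: finite_preimage finE => x y _ _; exact: val_inj.
apply: sub_finite_set finE' => x nfx /=.
have [->|[c xc]] := spec_line (set_val x); first by left.
right; exists c => //=; apply: contrapT => /negP /nonunit_sub_prime[p pu].
apply: nfx; exists p => //; apply: val_inj.
rewrite -[RHS]/(set_val x) xc; apply: eval_pointP.
apply: etrans (mem_mor f p ('X - c%:P)) _.
by rewrite pullback_adjoin rmorphB /= adjoinX adjoinC.
Qed.

Lemma unit_additive_constant (f : lrspace_mor X C) :
  finitely_generated i -> unit_additive R -> constant_mor f.
Proof.
move=> fgR uaR.
have [c uc] := unit_additive_scal fgR uaR (pullback_unit f).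
pose e : {rmorphism {poly k} -> k} := horner_eval c.
apply: (@constant_pullback _ _ _ _ _ _ f e) => h.
by rewrite pullback_adjoin uc adjoinE horner_map.
Qed.

Lemma not_unit_additive_dominant :
  ~ unit_additive R -> exists f : lrspace_mor X C, dominant_mor f.
Proof.
move=> nuaR.
(* If [a / b] were a scalar [i c], then [a + b = i (c + 1) * b] would be zero or a unit. *)
have [u Uu nu] : exists2 u : R, u \is a GRing.unit & forall c, u != i c.
  apply: contrapT => H; apply: nuaR => a b Ua Ub; apply: contrapT.
  move=> /not_orP[nU nN]; apply: H; exists (a / b).
    by rewrite unitrM Ua unitrV.
  move=> c; apply/eqP => abc.
  have E : a + b = i (c + 1) * b.
    by rewrite rmorphD rmorph1 mulrDl mul1r -abc divrK.
  have [c0|c0] := eqVneq (c + 1) 0.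
    by apply: nN; exists 1%N; rewrite E c0 rmorph0 mul0r.
  by apply: nU; rewrite E unitrM Ub rmorph_unit ?unitfE.
have tr := adjoin_transcendental nu.
have adjoin_scal c : adjoin i u c%:P = i c by rewrite adjoinC.
(* The unit [u], image of ['X], lies in no prime, so every contraction avoids the origin. *)
have inC p : oset (basic_open ('X : {poly k})) (contract (adjoin i u) p).
  rewrite /= mem_contract /= adjoinX; apply/negP => up.
  by have := idealr1 p; rewrite -(mulVr Uu) idealMr.
by exists (contract_mor tr adjoin_scal inC); exact: contract_mor_dominant.
Qed.

End ClosedPoints.

Theorem theorem4p2 (k : closedFieldType) (R : idomainType)
    (i : {rmorphism k -> R}) (fgR : finitely_generated i) :
  let X := affine_scheme i in
  let C := punctured_line k in
  let P1 := unit_additive R /\ forall f : lrspace_mor X C, constant_mor f in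
  let P2 := ~ unit_additive R /\
    (exists f : lrspace_mor X C, dominant_mor f) /\
    (forall f : lrspace_mor X C, dominant_mor f ->
       finite_set (~` range f)) in
  (P1 \/ P2) /\ ~ (P1 /\ P2).
Proof.
move=> X C P1 P2; split; last by move=> [[ua _] [nua _]].
have [uaR|nuaR] := pselect (unit_additive R); [left|right]; split=> //.
  by move=> f; exact: unit_additive_constant.
split; first exact: not_unit_additive_dominant.
by move=> f; exact: dominant_cofinite.
Qed.
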